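(* Let $t \ge 2$ be an integer and let $n \ge 1$ be a squarefree integer. Then $$ |L_t(n)| \le \begin{cases} 2n\exp\bigl( t\,\omega(n)^{1-\frac{1}{t}}\bigr) & \text{if } t = 2 \text{ and } \omega(n) \le 55,\\ n\exp\bigl( t\,\omega(n)^{1-\frac{1}{t}}\bigr) & \text{otherwise},\end{cases} $$ where $L_t(n)=\int_1^n M(n,z)^t\,dz$.
   Context: $\mu$ is the Möbius function and $\omega(n)$ is the number of distinct prime divisors of $n$. For an integer $n\ge 1$ and real $z$, $M(n,z):=\sum_{d\mid n,\ d\le z}\mu(d)$. For integers $t\ge 1$, $L_t(n):=\int_{1}^{n}M(n,z)^t\,dz$. *)

(* Defs.v *)
From mathcomp Require Import all_boot all_order all_algebra.
From mathcomp Require Import all_classical all_reals all_analysis.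

Set Implicit Arguments.
Unset Strict Implicit.
Unset Printing Implicit Defensive.

Import Order.TTheory GRing.Theory Num.Theory.
Import numFieldNormedType.Exports.

Local Open Scope classical_set_scope.
Local Open Scope ring_scope.

(* [primes 0] is empty, so 0 has to be excluded explicitly. *)
Definition squarefree (n : nat) : bool :=
  (0 < n)%N && all (fun p => ~~ (p ^ 2 %| n)%N) (primes n).

Definition omega (n : nat) : nat := size (primes n).

Definition moebius (n : nat) : int :=
  if squarefree n then (-1) ^+ omega n else 0.

Definition M (R : realType) (n : nat) (z : R) : R :=
  \sum_(d <- divisors n | d%:R <= z) (moebius d)%:~R.

(* The integrand is a step function, bounded and measurable, so the real-valued
   Lebesgue integral below is the usual one. *)
Definition L (R : realType) (t n : nat) : R :=
  \int[lebesgue_measure]_(z in `[1, n%:R]) (M n z) ^+ t.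

(* Main.v *)
Require Import Defs.
From mathcomp Require Import all_boot all_order all_algebra.
From mathcomp Require Import all_classical all_reals all_analysis.
From mathcomp Require Import zify ring lra.

(* The integrand is constant on each [j, j + 1[, so L_t is a finite sum. If p is a
   prime not dividing m, then M(pm, z) = M(m, z) - M(m, z / p); by Minkowski's
   inequality in L^t this multiplies the t-th absolute moment by at most
   (1 + p^(1/t))^t. Starting from the smallest prime q of n, whose moment is at most
   q, one gets |L_t(n)| <= n prod_(p | n, p <> q) (1 + p^(-1/t))^t, hence at most
   n exp(t sum_(p | n, p <> q) p^(-1/t)).
   It remains to bound this sum over K = omega(n) - 1 odd primes by K^(1 - 1/t).
   By concavity it suffices to treat t = 2. Then sqrt K - sqrt (K - 1) exceeds
   1 / sqrt p when p >= 4 K, which holds for the K-th odd prime as soon as K >= 30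
   (already among the integers prime to 210); smaller K are checked on a table. *)

Set Implicit Arguments.
Unset Strict Implicit.
Unset Printing Implicit Defensive.

Import Order.TTheory GRing.Theory Num.Theory.
Import numFieldNormedType.Exports.

Local Open Scope ring_scope.

(** * Squarefree numbers, divisors and the Möbius function under adjoining a prime *)

Lemma primes_mul_prime (p m : nat) :
  prime p -> ~~ (p %| m)%N -> perm_eq (primes (p * m)) (p :: primes m).
Proof.
move=> pp pm; have m0 : (0 < m)%N by rewrite lt0n; apply: contraNneq pm => ->; rewrite dvdn0.
apply: uniq_perm; first exact: primes_uniq.
  by rewrite /= primes_uniq mem_primes (negPf pm) !andbF.
by move=> q; rewrite (primesM _ (prime_gt0 pp) m0) primes_prime// !inE.
Qed.

Lemma squarefree_gt0 (n : nat) : squarefree n -> (0 < n)%N.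
Proof. by case/andP. Qed.

Lemma squarefreeP (n : nat) :
  reflect ((0 < n)%N /\ forall p, prime p -> ~~ (p ^ 2 %| n)%N) (squarefree n).
Proof.
apply: (iffP andP) => -[n0 sq]; split=> //.
  move=> p pp; have [pn|] := boolP (p \in primes n); first exact: (allP sq).
  rewrite mem_primes pp n0 /=; apply: contra => pn.
  by apply: dvdn_trans pn; rewrite expnS dvdn_mulr.
by apply/allP => p; rewrite mem_primes => /andP[pp _]; exact: sq.
Qed.

Lemma squarefree_dvd (d n : nat) : squarefree n -> (d %| n)%N -> squarefree d.
Proof.
move=> /squarefreeP[n0 sq] dn; apply/squarefreeP; split.
  exact: dvdn_gt0 dn.
by move=> p pp; apply: contra (sq p pp) => pd; exact: dvdn_trans dn.
Qed.

Lemma squarefree_mul_prime (p m : nat) : prime p -> ~~ (p %| m)%N ->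
  squarefree m -> squarefree (p * m).
Proof.
move=> pp pm /squarefreeP[m0 sq]; apply/squarefreeP; split.
  by rewrite muln_gt0 prime_gt0.
move=> q pq; have [->|qp] := eqVneq q p.
  by rewrite -mulnn dvdn_pmul2l ?prime_gt0.
rewrite Gauss_dvdr ?sq// coprimeXl// prime_coprime//.
by rewrite dvdn_prime2.
Qed.

Lemma squarefree_mul_prime_ndvd (p m : nat) :
  prime p -> squarefree (p * m) -> ~~ (p %| m)%N.
Proof.
move=> pp /squarefreeP[_ /(_ p pp)]; apply: contra => pm.
by rewrite -mulnn dvdn_pmul2l ?prime_gt0.
Qed.

Lemma moebius_mul_prime (p d : nat) : prime p -> ~~ (p %| d)%N ->
  squarefree d -> moebius (p * d) = - moebius d.
Proof.
move=> pp pd sd; rewrite /moebius squarefree_mul_prime// sd /omega.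
by rewrite (perm_size (primes_mul_prime pp pd)) /= exprS mulN1r.
Qed.

Lemma divisors_mul_prime (p m : nat) : prime p -> ~~ (p %| m)%N ->
  perm_eq (divisors (p * m)) (divisors m ++ [seq (p * d)%N | d <- divisors m]).
Proof.
move=> pp pm; have m0 : (0 < m)%N by rewrite lt0n; apply: contraNneq pm => ->; rewrite dvdn0.
have p0 := prime_gt0 pp.
apply: uniq_perm; first exact: divisors_uniq.
  rewrite cat_uniq divisors_uniq map_inj_uniq ?divisors_uniq; last first.
    by move=> x y /eqP; rewrite eqn_pmul2l// => /eqP.
  rewrite andbT /=; apply/hasPn => _ /mapP[d _ ->].
  rewrite -dvdn_divisors//; apply: contra pm; apply: dvdn_trans.
  exact: dvdn_mulr.
move=> d; rewrite mem_cat -!dvdn_divisors ?muln_gt0 ?p0//.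
have [pd|pd] := boolP (p %| d)%N.
  have -> : (d %| m)%N = false.
    by apply: contraNF pm; apply: dvdn_trans.
  case/dvdnP: pd => e ->; rewrite mulnC dvdn_pmul2l//=.
  rewrite mem_map -?dvdn_divisors// => x y /eqP.
  by rewrite eqn_pmul2l// => /eqP.
rewrite Gauss_dvdr; last by rewrite coprime_sym prime_coprime.
suff -> : d \in [seq (p * d)%N | d <- divisors m] = false by rewrite orbF.
by apply: contraNF pd => /mapP[e _ ->]; exact: dvdn_mulr.
Qed.

(** * The truncated Möbius sums at integer cutoffs *)

(** With an integer cutoff, the dilation z / p becomes the floor quotient [j %/ p]. *)
Definition mertens_div (n j : nat) : int :=
  \sum_(d <- divisors n | (d <= j)%N) moebius d.

(** The divisors of pm are the d and the pd with d | m; [moebius] changes sign from d to pd, and pd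
    <= j iff d <= [j %/ p]. *)
Lemma mertens_div_mul_prime (p m j : nat) : prime p -> ~~ (p %| m)%N ->
  squarefree m ->
  mertens_div (p * m) j = mertens_div m j - mertens_div m (j %/ p).
Proof.
move=> pp pm sm; rewrite /mertens_div.
rewrite (perm_big _ (divisors_mul_prime pp pm)) big_cat /= big_map.
congr (_ + _); rewrite -sumrN.
rewrite big_seq_cond [RHS]big_seq_cond; apply: eq_big.
  by move=> d; rewrite leq_divRL ?prime_gt0// mulnC.
move=> d /andP[]; rewrite -dvdn_divisors ?squarefree_gt0// => dm _.
apply: moebius_mul_prime => //; last exact: squarefree_dvd dm.
by apply: contra pm => pd; exact: dvdn_trans dm.
Qed.

Lemma mertens_div0 (n : nat) : (0 < n)%N -> mertens_div n 0 = 0.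
Proof.
move=> n0; rewrite /mertens_div big_seq_cond big_pred0// => d.
rewrite -dvdn_divisors//; case: d => [|d]; last by rewrite andbF.
by rewrite dvd0n; case: n n0.
Qed.

Lemma mertens_div1 (j : nat) : (0 < j)%N -> mertens_div 1 j = 1.
Proof. by move=> j0; rewrite /mertens_div big_cons big_nil /= j0. Qed.

Lemma mertens_div_big (n j : nat) : (0 < n)%N -> (n <= j)%N ->
  mertens_div n j = mertens_div n n.
Proof.
move=> n0 nj; rewrite /mertens_div big_seq_cond [RHS]big_seq_cond.
apply: eq_bigl => d; rewrite -dvdn_divisors//.
have [dn|//] := boolP (d %| n)%N.
by rewrite (dvdn_leq n0 dn) (leq_trans (dvdn_leq n0 dn) nj).
Qed.

(** Write n = pm with p the smallest prime factor: both cutoffs [j] and [j %/ p] are at least m, so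
    the recursion subtracts the full divisor sum of m from itself. *)
Lemma mertens_div_eq0 (n j : nat) : squarefree n -> (1 < n)%N -> (n <= j)%N ->
  mertens_div n j = 0.
Proof.
move=> sn n1; have pp := pdiv_prime n1.
case/dvdnP: (pdiv_dvd n) => m; rewrite mulnC => nE nj.
have p0 := prime_gt0 pp.
have sm : squarefree m by apply: squarefree_dvd sn _; rewrite nE dvdn_mull.
have m0 := squarefree_gt0 sm.
have pm : ~~ (pdiv n %| m)%N by apply: squarefree_mul_prime_ndvd; rewrite -?nE.
rewrite nE mertens_div_mul_prime// [X in X - _]mertens_div_big//; last first.
  by rewrite (leq_trans _ nj)// nE leq_pmull.
by rewrite mertens_div_big ?subrr// leq_divRL// mulnC -nE.
Qed.

(** * Moments and their growth when a prime is adjoined *)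

(** The quotient [j %/ p] takes each value below m exactly p times. *)
Lemma sum_divn (V : nmodType) (f : nat -> V) (p m : nat) : (0 < p)%N ->
  \sum_(0 <= j < p * m) f (j %/ p)%N = (\sum_(0 <= j < m) f j) *+ p.
Proof.
move=> p0; elim: m => [|m IH]; first by rewrite muln0 !big_geq// mul0rn.
rewrite big_nat_recr//= mulrnDl -IH mulnS addnC.
rewrite (@big_cat_nat _ _ _ (p * m)%N) ?leq_addr//=; congr (_ + _).
rewrite -[X in \sum_(X <= _ < _) _]add0n big_addn addKn.
under eq_big_nat => i /andP[_ ip].
  rewrite mulnC divnDMl// divn_small// add0n; over.
by rewrite sumr_const_nat subn0.
Qed.

(* Convexity of [x ^+ t.+1] with weights [1 / (1 + c)] and [c / (1 + c)]. *)
Lemma exprD_convex (R : realDomainType) (a v c : R) (t : nat) : 0 <= a -> 0 <= v -> 0 <= c ->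
  (a + c * v) ^+ t.+1 <= (1 + c) ^+ t * (a ^+ t.+1 + c * v ^+ t.+1).
Proof.
move=> a0 v0 c0; elim: t => [|t IH]; first by rewrite expr0 mul1r !expr1.
have acv0 : 0 <= a + c * v by rewrite addr_ge0// mulr_ge0.
rewrite exprSr; apply: le_trans (ler_wpM2r acv0 IH) _.
rewrite -mulrA [(1 + c) ^+ t.+1]exprSr -[leRHS]mulrA ler_wpM2l ?exprn_ge0 ?addr_ge0//.
rewrite -subr_ge0 [a ^+ t.+2]exprSr [v ^+ t.+2]exprSr.
set A := a ^+ _; set V := v ^+ _.
(* The two factors [A - V] and [a - v] have the same sign, since powers are increasing on
   nonnegative numbers. *)
have -> : (1 + c) * (A * a + c * (V * v)) - (A + c * V) * (a + c * v) =
  c * ((A - V) * (a - v)) by ring.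
rewrite mulr_ge0//; have [av|va] := leP a v.
  by rewrite mulr_le0// ?subr_le0// lerXn2r.
by rewrite mulr_ge0// ?subr_ge0 ?(ltW va)// lerXn2r// ltW.
Qed.

(** This is the integral of |M(n, z)|^t over [0, n[. Starting at 0 makes the blocks of length p in a
    dilation complete. *)
Definition mertens_moment (R : realType) (t n : nat) : R :=
  \sum_(0 <= j < n) `|(mertens_div n j)%:~R| ^+ t.

(** Below [q] only the divisor 1 can count. Starting the product from this bound spares [q] the
    factor (1 + q^(1/t))^t. *)
Lemma mertens_moment_prime (R : realType) (t q : nat) : prime q ->
  mertens_moment R t.+1 q <= q%:R.
Proof.
move=> pq; have q1 := prime_gt1 pq.
apply: (@le_trans _ _ (\sum_(0 <= j < q) 1)).
  apply: ler_sum_nat => -[|j] /= jq.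
    by rewrite mertens_div0 ?prime_gt0// normr0 expr0n.
  rewrite -{1}[q]muln1 mertens_div_mul_prime ?dvdn1 ?gtn_eqF//.
  by rewrite divn_small// mertens_div1// mertens_div0// subr0 normr1 expr1n.
by rewrite sumr_const_nat subn0.
Qed.

(* Minkowski's inequality: dilating by [p] multiplies the [t]-th moment by [p],
   so the triangle inequality gives the factor [(1 + p ^ (1 / t)) ^ t]. *)
Lemma mertens_moment_mul_prime (R : realType) (t p m : nat) (c : R) :
  prime p -> ~~ (p %| m)%N -> squarefree m -> (1 < m)%N ->
  0 < c -> c ^+ t.+1 = p%:R ->
  mertens_moment R t.+1 (p * m) <= (1 + c) ^+ t.+1 * mertens_moment R t.+1 m.
Proof.
move=> pp pm sm m1 c0 cp; have p0 := prime_gt0 pp.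
pose x j : R := `|(mertens_div m j)%:~R|.
have x0 i : 0 <= x i by exact: normr_ge0.
(* As m > 1, the terms from m on vanish. *)
have tail : \sum_(0 <= j < p * m) x j ^+ t.+1 = mertens_moment R t.+1 m.
  rewrite (@big_cat_nat _ _ _ m) ?leq_pmull//= [X in _ + X]big1_seq ?addr0// => j.
  rewrite mem_index_iota => /andP[_ /andP[mj _]].
  by rewrite /x mertens_div_eq0// normr0 expr0n.
(* Convexity is applied to x_j and x_(j/p) / c. Since c^(t+1) = p, both resulting power sums equal
   the moment of m, and the weights add the last factor 1 + c. *)
apply: (@le_trans _ _ (\sum_(0 <= j < p * m) (1 + c) ^+ t *
    (x j ^+ t.+1 + c * (x (j %/ p)%N / c) ^+ t.+1))).
  apply: ler_sum => j _.
  have xc0 : 0 <= x (j %/ p)%N / c by rewrite divr_ge0// ltW.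
  apply: le_trans (exprD_convex t (x0 j) xc0 (ltW c0)).
  rewrite [c * _]mulrC divfK ?gt_eqF// lerXn2r ?nnegrE ?addr_ge0//.
  by rewrite mertens_div_mul_prime// intrB ler_normB.
rewrite -mulr_sumr big_split/= tail -mulr_sumr.
under [X in _ + _ * X]eq_bigr do rewrite expr_div_n.
rewrite -mulr_suml (sum_divn (fun j => x j ^+ t.+1))// -/(mertens_moment R t.+1 m).
rewrite cp -[mertens_moment _ _ _ *+ _]mulr_natr mulfK ?pnatr_eq0 -?lt0n//.
rewrite exprSr -mulrA.
by rewrite mulrDl mul1r.
Qed.

Lemma prime_ndvd_prod (p : nat) (s : seq nat) : prime p -> all prime s ->
  p \notin s -> ~~ (p %| \prod_(q <- s) q)%N.
Proof.
move=> pp; elim: s => [|q s IH] /=; first by rewrite big_nil dvdn1 gtn_eqF ?prime_gt1.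
case/andP=> pq ps; rewrite inE negb_or => /andP[npq nps].
by rewrite big_cons Euclid_dvdM// negb_or dvdn_prime2// npq IH.
Qed.

Lemma squarefree_prod_primes (s : seq nat) : all prime s -> uniq s ->
  squarefree (\prod_(q <- s) q).
Proof.
elim: s => [|q s IH] /=; first by rewrite big_nil.
case/andP=> pq ps /andP[nqs us]; rewrite big_cons.
by apply: squarefree_mul_prime; rewrite ?IH// prime_ndvd_prod.
Qed.

(** The induction adjoins primes behind a fixed head [q], so the product always exceeds 1, as the
    multiplication step requires. *)
Lemma mertens_moment_prod (R : realType) (t q : nat) (s : seq nat) (c : nat -> R) :
  all prime (q :: s) -> uniq (q :: s) ->
  (forall p, prime p -> 0 < c p) ->
  (forall p, prime p -> c p ^+ t.+1 = p%:R) ->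
  mertens_moment R t.+1 (\prod_(p <- q :: s) p) <=
    q%:R * \prod_(p <- s) (1 + c p) ^+ t.+1.
Proof.
move=> pqs uqs c0 cp; elim: s pqs uqs => [|p s IH].
  by rewrite big_cons !big_nil muln1 mulr1 /= andbT => pq _; exact: mertens_moment_prime.
rewrite /= inE negb_or.
move=> /and3P[pq pp ps] /and3P[/andP[qp nqs] nps us].
have -> : (\prod_(r <- [:: q, p & s]) r = p * \prod_(r <- q :: s) r)%N.
  by rewrite !big_cons mulnCA.
have pqs : all prime (q :: s) by rewrite /= pq.
have uqs : uniq (q :: s) by rewrite /= nqs.
apply: (le_trans (mertens_moment_mul_prime pp _ _ _ (c0 p pp) (cp p pp))).
- by rewrite prime_ndvd_prod// inE negb_or eq_sym qp.
- exact: squarefree_prod_primes.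
- rewrite big_cons (leq_trans (prime_gt1 pq))// leq_pmulr//.
  exact: squarefree_gt0 (squarefree_prod_primes ps us).
rewrite [X in _ <= _ * X]big_cons mulrCA ler_wpM2l ?IH//.
by rewrite exprn_ge0// addr_ge0// ltW// c0.
Qed.

(** * From the integral to a finite sum *)

Lemma M_mertens_div (R : realType) (n j : nat) (z : R) :
  j%:R <= z < j.+1%:R -> M n z = (mertens_div n j)%:~R.
Proof.
move=> /andP[jz zj]; rewrite /M /mertens_div rmorph_sum/=.
apply: eq_bigl => d; apply/idP/idP => [dz|dj].
  by rewrite -ltnS -(ltr_nat R) (le_lt_trans dz).
by rewrite (le_trans _ jz)// ler_nat.
Qed.

Lemma measurable_M (R : realType) (n : nat) (D : set R) :
  measurable_fun D (M n).
Proof.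
rewrite /M; under eq_fun do rewrite big_mkcond.
apply: measurable_sum => d; apply: measurable_funTS.
apply: measurable_fun_ifT => //.
by apply: measurable_realfun.measurable_fun_ler.
Qed.

Lemma integrable_M (R : realType) (t n : nat) (a b : R) :
  lebesgue_measure.-integrable `[a, b] (EFin \o (fun z => M n z ^+ t)).
Proof.
apply: measurable_bounded_integrable => //.
- by rewrite /= lebesgue_measure_itv/=; case: ifP => // _; rewrite -EFinB ltry.
- by apply: measurable_realfun.measurable_funX; exact: measurable_M.
pose B : R := \sum_(d <- divisors n) `|(moebius d)%:~R|.
exists (B ^+ t); split; first exact: num_real.
move=> x /ltW Bx z _ /=; apply: le_trans Bx; rewrite normrX lerXn2r ?nnegrE//.
  by apply: sumr_ge0 => d _.
rewrite /M big_mkcond (le_trans (ler_norm_sum _ _ _))//.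
by apply: ler_sum => d _; case: ifP => // _; rewrite normr0.
Qed.

(** Integer points are null, so the values of [F] are prescribed on open unit intervals only. *)
Lemma Rintegral_step (R : realType) (F : R -> R) (g : nat -> R) (n : nat) :
  (forall a b, lebesgue_measure.-integrable `[a, b] (EFin \o F)) ->
  (forall j z, j%:R < z < j.+1%:R -> F z = g j) ->
  \int[lebesgue_measure]_(z in `[1, n.+1%:R]) F z = \sum_(1 <= j < n.+1) g j.
Proof.
move=> iF Fg; elim: n => [|n IH].
  by rewrite set_itv1 Rintegral_set1 big_geq.
rewrite big_nat_recr//= -IH; apply/eqP; rewrite addrC -subr_eq; apply/eqP.
rewrite Rintegral_itvB// ?bnd_simp ?ler_nat ?ler1n//.
rewrite -Rintegral_itv_bndo_bndc; last first.
  by apply: integrableS (iF n.+1%:R n.+2%:R) => //; apply: subset_itvW.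
rewrite (@eq_Rintegral _ _ _ _ _ (cst (g n.+1))); last first.
  by move=> z; rewrite inE/= in_itv/=; exact: Fg.
rewrite Rintegral_cst//=  lebesgue_measure_itv/= lte_fin ltr_nat leqnn/=.
by rewrite -natrB// subSnn mulr1.
Qed.

Lemma L_sum (R : realType) (t n : nat) : (0 < n)%N ->
  L R t n = \sum_(1 <= j < n) (mertens_div n j)%:~R ^+ t.
Proof.
case: n => // n _; rewrite /L.
apply: (Rintegral_step (g := fun j => (mertens_div n.+1 j)%:~R ^+ t)).
  by move=> a b; exact: integrable_M.
by move=> j z /andP[/ltW jz zj]; rewrite (@M_mertens_div _ _ j) ?jz.
Qed.

(** * Sums of inverse square roots of odd primes *)

(* Contains every odd prime, and has density [48 / 210 < 1 / 4]. *)
Definition sieve210 (m : nat) : bool :=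
  (m \in [:: 3; 5; 7]) || (1 < m)%N && coprime 210 m.

Definition sieve_count (x : nat) : nat := count sieve210 (iota 0 x).

Lemma sieve210_odd_prime (p : nat) : prime p -> (2 < p)%N -> sieve210 p.
Proof.
move=> pp p2; rewrite /sieve210 !inE prime_gt1//= coprime_sym prime_coprime//.
rewrite -[210%N]/(2 * 3 * 5 * 7)%N !Euclid_dvdM// !dvdn_prime2//.
by rewrite (gtn_eqF p2); do 3 case: eqP.
Qed.

Lemma sieve_countS (x : nat) : sieve_count x.+1 = (sieve_count x + sieve210 x)%N.
Proof. by rewrite /sieve_count -addn1 iotaD count_cat /= addn0. Qed.

Lemma leq_sieve_count (x y : nat) : (x <= y)%N ->
  (sieve_count x <= sieve_count y)%N.
Proof. by move=> /subnK <-; rewrite addnC /sieve_count iotaD count_cat leq_addr. Qed.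

(** A period contains phi(210) = 48 residues prime to 210; from 8 on, the exceptional values 1, 3,
    5, 7 are passed. *)
Lemma sieve_countD210 (x : nat) : (8 <= x)%N ->
  sieve_count (x + 210) = (sieve_count x + 48)%N.
Proof.
move=> /subnK <-; elim: (x - 8)%N => [|k IH]; first by vm_compute.
rewrite addSn [in LHS]addSn !sieve_countS IH addnAC; congr (_ + _ + _)%N.
rewrite /sieve210 /coprime gcdnDr !inE; congr nat_of_bool.
by do !congr (_ || _); lia.
Qed.

(** Raising K by 105 raises 4K by two periods, hence the count by 96 < 105. The 105 values from 30
    on are computed. *)
Lemma sieve_count_lt (K : nat) : (30 <= K)%N -> (sieve_count (4 * K) < K)%N.
Proof.
have base : all (fun j => sieve_count (4 * j) < j)%N (iota 30 105) by vm_compute.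
elim/ltn_ind: K => K IH K30; have [K135|K135] := ltnP K 135.
  by apply: (allP base); rewrite mem_iota K30.
have -> : (4 * K = 4 * (K - 105) + 210 + 210)%N by lia.
rewrite !sieve_countD210; [|lia|lia].
have := IH (K - 105)%N; lia.
Qed.

Lemma size_sieve_count (s : seq nat) (p : nat) : sorted ltn (rcons s p) ->
  all sieve210 (rcons s p) -> (size s < sieve_count p.+1)%N.
Proof.
move=> ss /allP sv; rewrite -(size_rcons s p) /sieve_count -size_filter.
apply: uniq_leq_size; first exact: (sorted_uniq ltn_trans ltnn).
move=> q qs; rewrite mem_filter sv// mem_iota add0n ltnS /=.
move: ss qs; rewrite (sorted_pairwise ltn_trans) pairwise_rcons mem_rcons inE.
by case/andP => /allP sp _ /predU1P[->//|/sp /ltnW].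
Qed.

Definition inv_sqrt_sum_le (R : realType) (K : nat) (S : R) :=
  forall s : seq nat, size s = K -> sorted ltn s -> all sieve210 s ->
    \sum_(p <- s) (Num.sqrt p%:R)^-1 <= S.

(** Among K + 1 sieve elements the largest is at least [o], because at most K lie below [o]; so it
    contributes at most 1 / sqrt o <= r. *)
Lemma inv_sqrt_sum_leS (R : realType) (K o : nat) (S r : R) :
  inv_sqrt_sum_le K S -> (sieve_count o <= K)%N -> 0 < r ->
  1 <= o%:R * r ^+ 2 -> inv_sqrt_sum_le K.+1 (S + r).
Proof.
move=> KS oK r0 or2 s; case/lastP: s => // s p; rewrite size_rcons => -[sK] ss sv.
have op : (o <= p)%N.
  rewrite leqNgt; apply/negP => /leq_sieve_count.
  by move: (size_sieve_count ss sv); rewrite sK; lia.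
have p0 : (0 < p)%N.
  by move: sv; rewrite all_rcons; case: p {ss op} => // /andP[].
move: ss sv; rewrite -cats1 big_cat big_seq1 all_cat => /cat_sorted2[ss _] /andP[sv _].
apply: lerD; first exact: KS.
have sp0 : 0 < Num.sqrt p%:R :> R by rewrite sqrtr_gt0 ltr0n.
rewrite -[leLHS]mul1r ler_pdivrMr// -(@ler_pXn2r _ 2) ?nnegrE ?mulr_ge0 ?(ltW r0) ?(ltW sp0)//.
rewrite expr1n exprMn sqr_sqrtr// mulrC (le_trans or2)// ler_wpM2r ?sqr_ge0//.
by rewrite ler_nat.
Qed.

(** With a = sqrt (K + 1) and b = sqrt K, take o = 4 (K + 1) = (2a)^2 and r = a - b: then 2a (a - b)
    >= (a + b) (a - b) = 1. *)
Lemma inv_sqrt_sum_le_tail (R : realType) (K : nat) : (29 <= K)%N ->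
  inv_sqrt_sum_le K (Num.sqrt K%:R : R) ->
  inv_sqrt_sum_le K.+1 (Num.sqrt K.+1%:R : R).
Proof.
move=> K29 KS; rewrite -[Num.sqrt K.+1%:R](subrK (Num.sqrt K%:R)) addrC.
have K1 : (Num.sqrt K.+1%:R : R) ^+ 2 = K%:R + 1 by rewrite sqr_sqrtr// natr1.
have K0 : (Num.sqrt K%:R : R) ^+ 2 = K%:R by rewrite sqr_sqrtr.
have ab : Num.sqrt K%:R < Num.sqrt K.+1%:R :> R.
  by rewrite ltr_sqrt ?ltr_nat ?ltr0n.
have b0 : 0 <= Num.sqrt K%:R :> R by exact: sqrtr_ge0.
apply: (inv_sqrt_sum_leS (o := (4 * K.+1)%N)) => //.
- by rewrite -ltnS sieve_count_lt.
- by rewrite subr_gt0.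
rewrite natrM; move: ab b0 K1 K0 (@natr1 R K).
set a := Num.sqrt K.+1%:R; set b := Num.sqrt _ => ab b0 K1 K0 <-.
rewrite -K1.
rewrite (_ : _ * _ = (2 * a * (a - b)) ^+ 2); last by ring.
rewrite -[leLHS](expr1n R 2) lerXn2r ?nnegrE//; last by nra.
by apply: mulr_ge0; lra.
Qed.

(* The [j]-th entry [(o, r)] consists of the [j]-th odd prime [o] and an integer
   [r >= 1000 / sqrt o]. *)
Definition small_odd_primes : seq (nat * nat) :=
  [:: (3, 578); (5, 448); (7, 378); (11, 302); (13, 278); (17, 243); (19, 230);
      (23, 209); (29, 186); (31, 180); (37, 165); (41, 157); (43, 153);
      (47, 146); (53, 138); (59, 131); (61, 129); (67, 123); (71, 119);
      (73, 118); (79, 113); (83, 110); (89, 106); (97, 102); (101, 100);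
      (103, 99); (107, 97); (109, 96); (113, 95)]%N.

(* [S / N] is the bound accumulated for the first [K] odd primes. *)
Fixpoint certified (R : realType) (N : R) (K : nat) (S : R)
    (tab : seq (nat * nat)) : Prop :=
  if tab is (o, r) :: tab' then
    [/\ (sieve_count o <= K)%N, 0 < r%:R :> R, N ^+ 2 <= o%:R * r%:R ^+ 2 :> R,
        (S + r%:R) ^+ 2 <= N ^+ 2 * K.+1%:R
      & certified N K.+1 (S + r%:R) tab']
  else True.

(** Each row is one application of [inv_sqrt_sum_leS] with increment r / N. Squared comparisons
    avoid evaluating any square root. *)
Lemma inv_sqrt_sum_le_certified (R : realType) (N : R) (K : nat) (S : R)
    (tab : seq (nat * nat)) :
  0 < N -> 0 <= S -> certified N K S tab -> inv_sqrt_sum_le K (S / N) ->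
  forall j, (K < j <= K + size tab)%N -> inv_sqrt_sum_le j (Num.sqrt j%:R : R).
Proof.
move=> N0; elim: tab K S => [|[q r] tab IH] K S S0; first by move=> _ _ j; rewrite addn0; lia.
move=> [qK r0 qr Sr ctab] KS.
have Sr0 : 0 <= S + r%:R by rewrite addr_ge0// ltW.
have KS' : inv_sqrt_sum_le K.+1 ((S + r%:R) / N).
  rewrite mulrDl; apply: (inv_sqrt_sum_leS KS qK).
    by rewrite divr_gt0.
  by rewrite expr_div_n mulrA ler_pdivlMr ?exprn_gt0// mul1r.
move=> j /andP[Kj jK]; have [<-|jK1] := eqVneq K.+1 j; last first.
  by apply: IH KS' _ _ => //; move: jK jK1 Kj; rewrite /= ; lia.
move=> s sK ss sv; apply: le_trans (KS' s sK ss sv) _.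
rewrite -(@ler_pXn2r _ 2) ?nnegrE ?divr_ge0 ?sqrtr_ge0 ?(ltW N0)// sqr_sqrtr// expr_div_n.
by rewrite ler_pdivrMr ?exprn_gt0// mulrC.
Qed.

Lemma small_odd_primes_certified (R : realType) :
  certified 1000 0 (0 : R) small_odd_primes.
Proof. by rewrite /=; do !(split; [by []|lra|lra|lra|]). Qed.

(** The 29 rows of the table reach exactly the length from which the tail step applies. *)
Lemma inv_sqrt_sum_le_sqrt (R : realType) (K : nat) :
  inv_sqrt_sum_le K (Num.sqrt K%:R : R).
Proof.
have small j : (j <= 29)%N -> inv_sqrt_sum_le j (Num.sqrt j%:R : R).
  have base : inv_sqrt_sum_le 0 (0 / 1000 : R).
    by move=> s /size0nil -> _ _; rewrite big_nil mul0r.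
  case: j => [_|j j29]; first by rewrite sqrtr0 -(mul0r 1000^-1).
  have N0 : 0 < 1000 :> R by lra.
  apply: (inv_sqrt_sum_le_certified N0 (lexx 0) (small_odd_primes_certified R) base).
  by rewrite add0n.
elim: K => [|K IH]; first exact: small.
have [K29|K29] := ltnP K 29; first exact: small.
exact: inv_sqrt_sum_le_tail.
Qed.

(** * Reduction of the exponent 1 / t to 1 / 2 by concavity *)

(** A concave power lies below its tangent at 1. *)
Lemma powR_le1D (R : realType) (y a : R) : 0 < y -> 0 <= a <= 1 ->
  y `^ a <= 1 + a * (y - 1).
Proof.
move=> y0 /andP[a0 a1]; rewrite /powR gt_eqF//.
rewrite -{2}(lnK y0); set w := ln y.
have E1 := expR_ge1Dx ((1 - a) * w); have E2 := expR_ge1Dx (- (a * w)).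
have e0 := expR_gt0 (a * w).
have h1 : expR (a * w) * (1 + (1 - a) * w) <= expR w.
  rewrite [leRHS](_ : _ = expR (a * w) * expR ((1 - a) * w)) ?ler_pM2l//.
  by rewrite -expRD; congr expR; ring.
have h2 : expR (a * w) * (1 - a * w) <= 1.
  by rewrite -[leRHS]expR0 -(subrr (a * w)) expRD ler_pM2l.
(* In [a] times [h1] plus [1 - a] times [h2], the terms in [w] cancel. *)
nra.
Qed.

(* Concavity of [y |-> y ^ (2 / t)]. *)
Lemma sum_powR_le (R : realType) (t : nat) (s : seq nat) : (2 <= t)%N ->
  all (fun p => 0 < p)%N s ->
  \sum_(p <- s) (Num.sqrt p%:R)^-1 <= Num.sqrt (size s)%:R :> R ->
  \sum_(p <- s) p%:R `^ (- t%:R^-1) <= (size s)%:R `^ (1 - t%:R^-1) :> R.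
Proof.
move=> t2 s0 sle; have [->|sn] := eqVneq s [::]; first by rewrite big_nil powR_ge0.
have K0 : (0 < size s)%N by rewrite lt0n size_eq0.
set K := size s in sle K0 *; have KR : 0 < K%:R :> R by rewrite ltr0n.
have t0 : 0 < t%:R :> R by rewrite ltr0n ltnW.
have a01 : 0 <= (2 : R) / t%:R <= 1.
  by rewrite divr_ge0//= ler_pdivrMr// mul1r ler_nat.
have sK0 : 0 < Num.sqrt K%:R :> R by rewrite sqrtr_gt0.
(* The tangent bound at y = sqrt (K / p), for which y^(2/t) = K^(1/t) p^(-1/t). *)
have term p : (0 < p)%N -> p%:R `^ (- t%:R^-1) <= K%:R `^ (- t%:R^-1) *
    (1 + 2 / t%:R * (Num.sqrt K%:R * (Num.sqrt p%:R)^-1 - 1)) :> R.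
  move=> p0; have pR : 0 < p%:R :> R by rewrite ltr0n.
  have sp0 : 0 < Num.sqrt p%:R :> R by rewrite sqrtr_gt0.
  have y0 : 0 < Num.sqrt K%:R * (Num.sqrt p%:R)^-1 :> R.
    by rewrite mulr_gt0 ?invr_gt0.
  have e (q : nat) : (0 < q)%N -> Num.sqrt q%:R `^ (2 / t%:R) = q%:R `^ t%:R^-1 :> R.
    by move=> q0; rewrite powRrM powR_mulrn ?sqrtr_ge0// sqr_sqrtr.
  apply: le_trans (ler_wpM2l _ (powR_le1D y0 a01)); last exact: powR_ge0.
  rewrite powRM ?(ltW sK0) ?invr_ge0 ?(ltW sp0)// e// mulrA -powRD ?(gt_eqF KR) ?implybT//.
  rewrite addNr powRr0 mul1r -[(Num.sqrt p%:R)^-1]powR_inv1 ?(ltW sp0)// -powRrM mulN1r.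
  by rewrite !powRN e.
rewrite big_seq; apply: (@le_trans _ _ (\sum_(p <- s | p \in s) K%:R `^ (- t%:R^-1) *
    (1 + 2 / t%:R * (Num.sqrt K%:R * (Num.sqrt p%:R)^-1 - 1)))).
  by apply: ler_sum => p ps; apply: term; exact: (allP s0).
rewrite -big_seq -mulr_sumr addrC powRD ?(gt_eqF KR) ?implybT// powRr1 ?(ltW KR)//.
rewrite ler_wpM2l ?powR_ge0// big_split/= -mulr_sumr sumrB -mulr_sumr.
rewrite big_const_seq count_predT iter_addr_0 -/K.
(* The summed linear terms are 2/t times sqrt K times the sum of the 1 / sqrt p, minus K; this is at
   most 0. *)
have := ler_wpM2l (ltW sK0) sle; rewrite -expr2 sqr_sqrtr//.
move/andP: a01 => [a0 _]; nra.
Qed.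

(** * Assembly of the bound from the primes of [n] *)

Lemma squarefree_prod (n : nat) : squarefree n ->
  n = (\prod_(p <- primes n) p)%N.
Proof.
case/squarefreeP => n0 sq.
rewrite [LHS](prod_prime_decomp n0) prime_decompE big_map big_seq [RHS]big_seq.
apply: eq_bigr => p pn /=; move: (pn); rewrite mem_primes => /andP[pp _].
suff -> : logn p n = 1%N by rewrite expn1.
apply/eqP; rewrite eqn_leq logn_gt0 pn andbT leqNgt.
by rewrite -pfactor_dvdn// sq.
Qed.

(** Every prime after the smallest is odd, hence passes the sieve; the bound in the number of these
    primes is then relaxed to [omega n]. *)
Lemma sum_primes_powR_le (R : realType) (t n : nat) : (2 <= t)%N ->
  \sum_(p <- behead (primes n)) p%:R `^ (- t%:R^-1) <=
    (omega n)%:R `^ (1 - t%:R^-1) :> R.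
Proof.
move=> t2; set s := behead (primes n).
have ps : all prime s.
  by apply/allP => p /mem_behead; rewrite mem_primes => /andP[].
have s_sorted : sorted ltn s.
  by move: (sorted_primes n); rewrite /s; case: primes => // q r /path_sorted.
have s_sieve : all sieve210 s.
  apply/allP => p p_s; apply: sieve210_odd_prime; first exact: (allP ps).
  move: p_s (sorted_primes n) (all_prime_primes n); rewrite /s.
  case: primes => // q r /= pr; rewrite (path_sortedE ltn_trans).
  by move=> /andP[/allP/(_ p pr) qp _] /andP[/prime_gt1 q1 _]; exact: leq_trans qp.
have s_gt0 : all (fun p => 0 < p)%N s.
  by apply: sub_all ps => p; exact: prime_gt0.
have s_le := inv_sqrt_sum_le_sqrt R (erefl (size s)) s_sorted s_sieve.
apply: le_trans (sum_powR_le t2 s_gt0 s_le) _.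
rewrite ge0_ler_powR ?nnegrE ?ler0n// ?ler_nat ?size_behead ?leq_pred//.
by rewrite subr_ge0 invf_le1 ?ltr0n ?ler1n// ltnW.
Qed.

(** Factor 1 + p^(1/t) = p^(1/t) (1 + p^(-1/t)) and use 1 + x <= exp x. *)
Lemma prod_expr_powR_le (R : realType) (t : nat) (s : seq nat) : (0 < t)%N ->
  all (fun p => 0 < p)%N s ->
  \prod_(p <- s) (1 + p%:R `^ t%:R^-1) ^+ t <=
    (\prod_(p <- s) p)%:R *
    expR (t%:R * \sum_(p <- s) p%:R `^ (- t%:R^-1)) :> R.
Proof.
move=> t0; elim: s => [|p s IH] /=; first by rewrite !big_nil mulr0 expR0 mulr1.
case/andP=> p0 s0; rewrite !big_cons natrM mulrDr expRD mulrACA.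
have tn0 : t%:R != 0 :> R by rewrite pnatr_eq0 -lt0n.
have p_neq0 : p%:R != 0 :> R by rewrite pnatr_eq0 -lt0n.
apply: ler_pM; [by rewrite exprn_ge0// addr_ge0// powR_ge0| | |exact: IH].
  by apply: prodr_ge0 => q _; rewrite exprn_ge0// addr_ge0// powR_ge0.
have ptE : p%:R = (p%:R `^ t%:R^-1) ^+ t :> R.
  by rewrite -powR_mulrn ?powR_ge0// -powRrM mulVf// powRr1.
rewrite [X in X * _]ptE [t%:R * _]mulrC expRM_natr -exprMn.
rewrite lerXn2r ?nnegrE ?mulr_ge0 ?addr_ge0 ?powR_ge0 ?expR_ge0//.
have -> : 1 + p%:R `^ t%:R^-1 = p%:R `^ t%:R^-1 * (1 + p%:R `^ (- t%:R^-1)) :> R.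
  by rewrite mulrDr mulr1 -powRD ?p_neq0 ?implybT// subrr powRr0 addrC.
by rewrite ler_wpM2l ?powR_ge0// expR_ge1Dx.
Qed.

Lemma normr_L_le (R : realType) (t n : nat) : (2 <= t)%N -> squarefree n ->
  `|L R t n| <= n%:R * expR (t%:R * (omega n)%:R `^ (1 - t%:R^-1)).
Proof.
move=> t2 sn; have n0 := squarefree_gt0 sn; rewrite L_sum//.
have [n1|n1] := leqP n 1; first by rewrite big_geq// normr0 mulr_ge0 ?expR_ge0.
apply: (@le_trans _ _ (mertens_moment R t n)).
  rewrite /mertens_moment (big_ltn n0) -[leLHS]add0r lerD ?exprn_ge0//.
  rewrite (le_trans (ler_norm_sum _ _ _))//.
  by apply: ler_sum => j _; rewrite normrX.
have := sum_primes_powR_le R n t2; have := squarefree_prod sn.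
have := all_prime_primes n; have := primes_uniq n.
case: (primes n) => [_ _ nE|q s uqs pqs nE /= s_le].
  by move: n1; rewrite nE big_nil.
case: t t2 s_le => // t t2 s_le.
have s0 : all (fun p => 0 < p)%N s.
  by case/andP: pqs => _; apply: sub_all => p; exact: prime_gt0.
rewrite {1}nE; apply: (le_trans (mertens_moment_prod
  (c := fun p => p%:R `^ t.+1%:R^-1) pqs uqs _ _)).
- by move=> p /prime_gt0 p0; rewrite powR_gt0// ltr0n.
- by move=> p _; rewrite -powR_mulrn ?powR_ge0// -powRrM mulVf ?powRr1.
apply: (le_trans (ler_wpM2l (ler0n _ _) (prod_expr_powR_le R (ltn0Sn t) s0))).
(* The bound [q] for the initial moment and the product of the other primes recombine to [n]. *)
rewrite mulrA -natrM [X in _ <= X%:R * _]nE big_cons.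
by rewrite ler_wpM2l// ler_expR ler_wpM2l.
Qed.

Theorem theorem1p2 (R : realType) (t n : nat)
    (ht : (2 <= t)%N) (hn : (1 <= n)%N) (hsq : squarefree n) :
  `|L R t n| <=
    if (t == 2)%N && (omega n <= 55)%N
    then 2 * n%:R * expR (t%:R * (omega n)%:R `^ (1 - 1 / t%:R))
    else n%:R * expR (t%:R * (omega n)%:R `^ (1 - 1 / t%:R)).
Proof.
rewrite div1r; have := normr_L_le R ht hsq; case: ifP => // _ Lle.
(* The case left is the one with the factor 2, weaker than [Lle]. *)
apply: le_trans Lle _; rewrite -mulrA ler_peMl ?mulr_ge0 ?expR_ge0//.
by rewrite ler1n.
Qed.
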